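(* Let $\alpha,\beta>0$ be rationally independent real numbers. For any two complex numbers $p,q$ there is a measurable function $f:\mathbb{R}\to\mathbb{C}$ with $\operatorname{mes}(\operatorname{supp} f)\le \alpha+\beta$ such that $$\sum_{k\in\mathbb{Z}} f(x-k\alpha)=p,\qquad \sum_{k\in\mathbb{Z}} f(x-k\beta)=q\qquad\text{for a.e. } x\in\mathbb{R},$$ where both series converge absolutely for a.e. $x$.
   Context: Two positive real numbers $\alpha,\beta$ are rationally independent if $n\alpha+m\beta=0$ with $n,m\in\mathbb{Z}$ implies $n=m=0$ (equivalently, $\alpha/\beta$ is irrational). The support of a function $f$ is the set $\operatorname{supp} f=\{x: f(x)\ne 0\}$ (no closure is taken). $\operatorname{mes}$ denotes Lebesgue measure on $\mathbb{R}$. *)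

(* Defs.v *)
From mathcomp Require Import all_boot all_order all_algebra finmap complex.
From mathcomp Require Import all_classical all_reals all_analysis.
From mathcomp Require summability.

Set Implicit Arguments.
Unset Strict Implicit.
Unset Printing Implicit Defensive.

Import Order.TTheory GRing.Theory Num.Theory.
Import numFieldNormedType.Exports.

Local Open Scope classical_set_scope.
Local Open Scope ring_scope.

Definition rationally_independent (R : realType) (a b : R) : Prop :=
  forall n m : int, n%:~R * a + m%:~R * b = 0 -> n = 0 /\ m = 0.

(* R with the sigma-algebra of Lebesgue (not only Borel) measurable sets, on
   which completed_lebesgue_measure is defined; as a type it unfolds to R. *)
Definition lebesgueType (R : realType) :=
  caratheodory_type ((@wlength R idfun)^*)%mu.

(* C with its Borel sigma-algebra. The topology of R[i] is inferred only through
   its alias R[i]^o, the normed space R[i] over itself. *)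
Definition borelComplex (R : realType) :=
  g_sigma_algebraType [set U : set R[i]^o | open U].

Definition lebesgue_measurable_fun (R : realType) (f : R -> R[i]) : Prop :=
  measurable_fun setT (f : lebesgueType R -> borelComplex R).

Definition supp (R : realType) (f : R -> R[i]) : set R := [set x | f x != 0].

(* Normc.normc is the modulus with values in R; `|z| lives in R[i]. *)
Definition absolutely_convergent (R : realType) (u : int -> R[i]) : Prop :=
  summable [set: int] (fun k => (Normc.normc (u k))%:E).

(* Convergence of the partial sums along the finite subsets of int ordered by
   inclusion; for an absolutely convergent series every ordering of the terms
   gives this same sum. *)
Definition sums_to (R : realType) (u : int -> R[i]) (s : R[i]) : Prop :=
  summability.partial_sum u @ summability.totally --> (s : R[i]^o).

(* Main.v *)
(* Regard each real x as an edge joining x mod alpha to x mod beta: the sums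
   over alpha Z and beta Z become the vertex sums of a weighted bipartite graph.
   Run the subtractive Euclidean algorithm on the unsaturated vertices
   [0, a[ mod alpha, still lacking p, and [0, b[ mod beta, still lacking q,
   starting from a = alpha and b = beta. If a < b, then the a-interval is joined
   to the last part [b - a, b[ of the b-interval by the edges of one interval of
   length a, all carrying the weight q; this saturates [b - a, b[, leaves b - a
   in place of b, and p - q in place of p. The case b < a is symmetric, and a = b
   never happens by independence. Such an edge interval exists because b - a is an
   integral combination of alpha and beta. The intervals used are disjoint, each
   step decreases a + b by the length used, and a and b tend to 0, so that every
   vertex other than 0 is saturated after finitely many steps. *)
Require Import Defs.
From mathcomp Require Import all_boot all_order all_algebra complex finmap.
From mathcomp Require Import ring lra.
From mathcomp Require Import all_classical all_reals all_analysis.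
From mathcomp Require summability.

Set Implicit Arguments.
Unset Strict Implicit.
Unset Printing Implicit Defensive.

Import Order.TTheory GRing.Theory Num.Theory.
Import numFieldNormedType.Exports.

Local Open Scope classical_set_scope.
Local Open Scope ring_scope.

(** * Sums over [int] with finitely many nonzero terms *)

Definition finitely_sums_to (V : zmodType) (u : int -> V) (s : V) : Prop :=
  exists2 J : {fset int}, forall k, k \notin J -> u k = 0 & \sum_(k <- J) u k = s.

Lemma finitely_sums_to0 (V : zmodType) (u : int -> V) :
  (forall k, u k = 0) -> finitely_sums_to u 0.
Proof. by move=> u0; exists fset0 => //; rewrite big_seq_fset0. Qed.

Lemma finitely_sums_to1 (V : zmodType) (u : int -> V) (k0 : int) :
  (forall k, k != k0 -> u k = 0) -> finitely_sums_to u (u k0).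
Proof.
move=> u0; exists [fset k0]%fset; last by rewrite big_seq_fset1.
by move=> k; rewrite in_fset1; exact: u0.
Qed.

Lemma finitely_sums_toD (V : zmodType) (u v : int -> V) (s t : V) :
  finitely_sums_to u s -> finitely_sums_to v t ->
  finitely_sums_to (fun k => u k + v k) (s + t).
Proof.
move=> [J uJ <-] [K vK <-]; exists (J `|` K)%fset.
  by move=> k; rewrite in_fsetU negb_or => /andP[/uJ -> /vK ->]; rewrite addr0.
rewrite big_split /=; congr (_ + _); apply/esym.
- by apply: big_fset_incl; [exact: fsubsetUl|move=> k _; exact: uJ].
- by apply: big_fset_incl; [exact: fsubsetUr|move=> k _; exact: vK].
Qed.

Lemma normc_ge0 (R : rcfType) (z : R[i]) : 0 <= Normc.normc z.
Proof. by case: z => x y; exact: sqrtr_ge0. Qed.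

Lemma finitely_sums_to_converges (R : realType) (u : int -> R[i]) (s : R[i]) :
  finitely_sums_to u s -> absolutely_convergent u /\ sums_to u s.
Proof.
move=> [J uJ <-]; split.
- rewrite /absolutely_convergent /summable.
  under eq_esum => k _ do rewrite gee0_abs ?lee_fin ?normc_ge0//.
  have -> : (\esum_(k in [set: int]) (Normc.normc (u k))%:E =
      \esum_(k in [set` J]) (Normc.normc (u k))%:E)%E.
    rewrite [RHS]esum_mkcond; apply: eq_esum => k _.
    case: ifPn => //; rewrite notin_setE/= => /negP kJ.
    by rewrite uJ// Normc.normc0.
  rewrite esum_fset//; last by move=> k _; rewrite lee_fin normc_ge0.
  by rewrite fsbig_finite//= sumEFin ltry.
- have tf := @summability.totally_filter int.
  apply: (@cvg_near_cst _ R[i]^o _ _ _ tf).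
  (* Every finite set containing [J] has the same partial sum, so the partial sums are eventually
     constant. *)
  exists J => //= B JB.
  rewrite /summability.partial_sum -(@big_seq_fsetE _ _ _ _ _ xpredT u)/=.
  by rewrite -(@big_fset_incl _ _ +%R _ J B u JB) ?eqxx// => k _; exact: uJ.
Qed.

(** * Images of intervals in the circle [R / c Z] *)

Definition meets (R : realType) (c s l x : R) : Prop :=
  exists k : int, x - k%:~R * c \in `[s, s + l[.

Section meets.
Context (R : realType) (c : R).
Hypothesis c_gt0 : 0 < c.

Lemma meets_period (x : R) : meets c 0 c x.
Proof.
exists (Num.floor (x / c)); have := floor_itv (x / c).
rewrite in_itv/= add0r intrD ler_pdivlMr// ltr_pdivrMr// => /andP[? ?].
by apply/andP; split; lra.
Qed.

(** Two points of a half-open interval of length at most [c] differ by less than [c], so [k] and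
    [k'] differ by less than 1. *)
Lemma translate_unique (s l x : R) (k k' : int) : l <= c ->
  x - k%:~R * c \in `[s, s + l[ -> x - k'%:~R * c \in `[s, s + l[ -> k = k'.
Proof.
move=> lc; rewrite !in_itv/= => /andP[h1 h2] /andP[h3 h4].
apply/eqP; rewrite eq_le -!(@ltzD1) -!(ltr_int R) !intrD.
by apply/andP; split; rewrite -(ltr_pM2r c_gt0); lra.
Qed.

Lemma meets_shift (m : int) (s l x : R) :
  meets c (s + m%:~R * c) l x <-> meets c s l x.
Proof.
by split=> -[k hk]; [exists (k + m)|exists (k - m)]; move: hk;
  rewrite !in_itv/= ?intrD ?intrN => /andP[? ?]; apply/andP; split; lra.
Qed.

Lemma meets_translate (m : int) (s l x : R) :
  meets c s l (x - m%:~R * c) <-> meets c s l x.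
Proof.
by split=> -[k hk]; [exists (k + m)|exists (k - m)]; move: hk;
  rewrite !in_itv/= ?intrD ?intrN => /andP[? ?]; apply/andP; split; lra.
Qed.

Lemma meets_le (s l l' x : R) : l <= l' -> meets c s l x -> meets c s l' x.
Proof.
by move=> ll' [k]; rewrite in_itv/= => /andP[? ?]; exists k; rewrite in_itv/=;
  apply/andP; split; lra.
Qed.

Lemma meets_split (a d x : R) : 0 <= d <= a ->
  meets c 0 a x <-> meets c 0 d x \/ meets c d (a - d) x.
Proof.
move=> /andP[d0 da]; split=> [[k]|[] [k]]; rewrite in_itv/= => /andP[h1 h2].
- have [h|h] := ltP (x - k%:~R * c) d.
    by left; exists k; rewrite in_itv/=; apply/andP; split; lra.
  by right; exists k; rewrite in_itv/=; apply/andP; split; lra.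
- by exists k; rewrite in_itv/=; apply/andP; split; lra.
- by exists k; rewrite in_itv/=; apply/andP; split; lra.
Qed.

Lemma meets_disjoint (a d x : R) : 0 <= d <= a -> a <= c ->
  meets c 0 d x -> ~ meets c d (a - d) x.
Proof.
move=> /andP[d0 da] ac [k hk] [k' hk'].
have kk' : k = k'.
  by apply: (@translate_unique 0 a x) => //; move: hk hk';
    rewrite !in_itv/= => /andP[? ?] /andP[? ?]; apply/andP; split; lra.
by move: hk hk'; rewrite kk' !in_itv/= => /andP[? ?] /andP[? ?]; lra.
Qed.

Lemma finitely_sums_to_indicator (V : zmodType) (v : V) (s l x : R) : l <= c ->
  finitely_sums_to (fun k : int => v *+ (x - k%:~R * c \in `[s, s + l[))
    (if `[< meets c s l x >] then v else 0).
Proof.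
move=> lc; case: asboolP => [[k0 hk0]|no].
  have := @finitely_sums_to1 V
    (fun k : int => v *+ (x - k%:~R * c \in `[s, s + l[)) k0.
  rewrite /= hk0 mulr1n; apply => k; apply: contra_neq_eq.
  case: (boolP (_ \in _)) => [hk _|_]; last by rewrite mulr0n eqxx.
  exact: (translate_unique lc hk hk0).
apply: finitely_sums_to0 => k; case: (boolP (_ \in _)) => // hk.
by case: no; exists k.
Qed.

(** The bound [e] is the representative of [x] mod [c] in [[0, c[], which is positive because [x] is
    not a multiple of [c]. *)
Lemma meets_small (x : R) : (forall k : int, x != k%:~R * c) ->
  exists2 e, 0 < e & forall a, a <= e -> ~ meets c 0 a x.
Proof.
move=> xc; have [k hk] := meets_period x.
move: (hk); rewrite in_itv/= => /andP[h1 h2].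
exists (x - k%:~R * c); first by rewrite lt_neqAle eq_sym subr_eq0 xc.
move=> a ae [k' hk']; have kk' : k = k'.
  apply: (@translate_unique 0 c x) => //; move: hk'.
  by rewrite !in_itv/= => /andP[? ?]; apply/andP; split; lra.
by move: hk'; rewrite -kk' in_itv/= => /andP[? ?]; lra.
Qed.

End meets.

(** * The descent and its invariants *)

(* Step [n] of the descent in the case [a n < b n]; the other case is
   [absorbs beta alpha b q a p]. The edges used are [s n, s n + l n[, of weight
   [v n]; the last two fields say that they join [0, a n[ mod [alpha] to
   [b n - a n, b n[ mod [beta]. *)
Record absorbs (R : realType) (alpha beta : R) (a : nat -> R) (p : nat -> R[i])
    (b : nat -> R) (q : nat -> R[i]) (s l : nat -> R) (v : nat -> R[i])
    (n : nat) : Prop := Absorbs {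
  absorbs_lt : a n < b n;
  absorbs_a : a n.+1 = a n;
  absorbs_b : b n.+1 = b n - a n;
  absorbs_p : p n.+1 = p n - q n;
  absorbs_q : q n.+1 = q n;
  absorbs_v : v n = q n;
  absorbs_l : l n = a n;
  absorbs_alpha : exists k : int, s n = k%:~R * alpha;
  absorbs_beta : exists k : int, s n = b n - a n + k%:~R * beta }.

Record descent (R : realType) (alpha beta : R) (p0 q0 : R[i])
    (a : nat -> R) (p : nat -> R[i]) (b : nat -> R) (q : nat -> R[i])
    (s l : nat -> R) (v : nat -> R[i]) : Prop := Descent {
  descent_a0 : a 0%N = alpha;
  descent_b0 : b 0%N = beta;
  descent_p0 : p 0%N = p0;
  descent_q0 : q 0%N = q0;
  descent_gt0 : forall n, 0 < a n /\ 0 < b n;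
  descent_step : forall n, absorbs alpha beta a p b q s l v n \/
                           absorbs beta alpha b q a p s l v n }.

(** Lets each fact below about [alpha], [a], [p] be transferred to [beta], [b], [q]. *)
Lemma descent_sym (R : realType) (alpha beta : R) (p0 q0 : R[i])
    (a : nat -> R) (p : nat -> R[i]) (b : nat -> R) (q : nat -> R[i])
    (s l : nat -> R) (v : nat -> R[i]) :
  descent alpha beta p0 q0 a p b q s l v ->
  descent beta alpha q0 p0 b q a p s l v.
Proof.
by case=> *; split=> // n; [exact/and_comm|exact/or_comm].
Qed.

Section descent.
Context (R : realType) (alpha beta : R) (p0 q0 : R[i])
  (a : nat -> R) (p : nat -> R[i]) (b : nat -> R) (q : nat -> R[i])
  (s l : nat -> R) (v : nat -> R[i]).
Hypothesis D : descent alpha beta p0 q0 a p b q s l v.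

Let a_gt0 n : 0 < a n. Proof. exact: (descent_gt0 D n).1. Qed.
Let b_gt0 n : 0 < b n. Proof. exact: (descent_gt0 D n).2. Qed.
Let alpha_gt0 : 0 < alpha. Proof. by rewrite -(descent_a0 D). Qed.

Lemma descent_leS n : a n.+1 <= a n.
Proof.
case: (descent_step D n) => H; first by rewrite (absorbs_a H).
by rewrite (absorbs_b H) lerBlDr lerDl ltW.
Qed.

Lemma descent_le m n : (m <= n)%N -> a n <= a m.
Proof.
move=> /subnK <-; elim: (n - m)%N => // j IH.
by rewrite addSn (le_trans (descent_leS _)).
Qed.

Lemma descent_le_period n : a n <= alpha.
Proof. by rewrite -(descent_a0 D); exact: descent_le. Qed.

Lemma descent_length n : 0 < l n <= a n.
Proof.
case: (descent_step D n) => H; rewrite (absorbs_l H) ?a_gt0 ?lexx//.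
by rewrite b_gt0 ltW// (absorbs_lt H).
Qed.

(** Telescoping, as each step lowers [a + b] by [l n]. This keeps the total length of the edge
    intervals below [alpha + beta]. *)
Lemma descent_sum_length n : \sum_(0 <= i < n) l i = alpha + beta - a n - b n.
Proof.
elim: n => [|n IH]; first by rewrite big_geq// (descent_a0 D) (descent_b0 D); ring.
rewrite big_nat_recr//= IH.
by case: (descent_step D n) => -[] _ -> -> _ _ _ -> _ _; ring.
Qed.

(** Modulo [alpha], the edges of step [n] start at 0 or at [a n - b n], so that they end only at
    vertices of [[0, a n[]. *)
Lemma descent_shift n : exists2 d, 0 <= d <= a n - l n &
  exists k : int, s n = d + k%:~R * alpha.
Proof.
case: (descent_step D n) => H; rewrite (absorbs_l H).
  exists 0; first by rewrite subrr lexx.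
  by have [k ->] := absorbs_alpha H; exists k; rewrite add0r.
exists (a n - b n); last exact: absorbs_beta H.
by rewrite lexx subr_ge0 ltW// (absorbs_lt H).
Qed.

Lemma descent_meets n x : x \in `[s n, s n + l n[ -> meets alpha 0 (a n) x.
Proof.
have [d /andP[d0 da] [k ->]] := descent_shift n.
rewrite in_itv/= => /andP[? ?]; exists k; rewrite in_itv/=.
by apply/andP; split; lra.
Qed.

(** Modulo [alpha] these edges fill exactly [[a n.+1, a n[], the part that step [n] removes. *)
Lemma descent_absorbed n x : absorbs beta alpha b q a p s l v n ->
  x \in `[s n, s n + l n[ -> ~ meets alpha 0 (a n.+1) x.
Proof.
move=> H xI; rewrite (absorbs_b H) => xa.
have ba := absorbs_lt H; have b0 := b_gt0 n.
apply: (meets_disjoint alpha_gt0 _ (descent_le_period n) xa).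
  by apply/andP; split; lra.
have [k sE] := absorbs_beta H; apply/(meets_shift _ k); exists 0.
rewrite mul0r subr0 -sE; move: xI; rewrite (absorbs_l H) !in_itv/= => /andP[? ?].
by apply/andP; split; lra.
Qed.

(** Invariant of the descent: after [n] steps a vertex still in [[0, a n[] mod [alpha] lacks [p n],
    and any other vertex has received all of [p0]. *)
Lemma descent_partial_sum n x :
  finitely_sums_to
    (fun k : int => \sum_(0 <= i < n) v i *+ (x - k%:~R * alpha \in `[s i, s i + l i[))
    (p0 - (if `[< meets alpha 0 (a n) x >] then p n else 0)).
Proof.
elim: n => [|n IH].
  rewrite (descent_a0 D) asboolT; last exact: meets_period.
  rewrite (descent_p0 D) subrr.
  by apply: finitely_sums_to0 => k; rewrite big_geq.
have lalpha : l n <= alpha.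
  by rewrite (le_trans _ (descent_le_period n))//; case/andP: (descent_length n).
have := finitely_sums_toD IH
  (finitely_sums_to_indicator alpha_gt0 (v n) (s n) x lalpha).
under eq_fun do rewrite -big_nat_recr//=.
congr finitely_sums_to; case: (descent_step D n) => H.
(* Every vertex of [[0, a n[] receives [q n], which is what [p] loses. *)
- have [k sE] := absorbs_alpha H.
  have -> : `[< meets alpha (s n) (l n) x >] = `[< meets alpha 0 (a n) x >].
    rewrite sE -[_ * _]add0r (absorbs_l H); apply: asbool_equiv_eq; exact: meets_shift.
  rewrite (absorbs_a H) (absorbs_p H) (absorbs_v H).
  by case: asboolP => _; ring.
(* The vertices of [[a n - b n, a n[] receive the [p n] they lack; those of [[0, a n - b n[] are
   untouched. *)
- have [k sE] := absorbs_beta H.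
  have -> : `[< meets alpha (s n) (l n) x >] =
            `[< meets alpha (a n - b n) (a n - (a n - b n)) x >].
    rewrite sE (absorbs_l H) subKr; apply: asbool_equiv_eq; exact: meets_shift.
  have ab : 0 <= a n - b n <= a n.
    by have := absorbs_lt H; have := b_gt0 n => ? ?; apply/andP; split; lra.
  rewrite (absorbs_b H) (absorbs_q H) (absorbs_v H).
  rewrite (asbool_equiv_eq (meets_split _ _ ab)) asbool_or.
  have := meets_disjoint alpha_gt0 ab (descent_le_period n) (x := x).
  case: asboolP => h1; case: asboolP => h2 h/=; try ring.
  by case: (h h1 h2).
Qed.

(* If [a n] stayed above [e], then [b] would drop by at least [e] infinitely
   often, because between two drops [a] decreases by the fixed amount [b n]. *)
Lemma descent_small (e : R) : 0 < e -> exists n, a n < e.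
Proof.
move=> e0; apply: contrapT => /forallNP noe.
have ae n : e <= a n by rewrite leNgt; apply/negP; exact: noe.
have drop n : exists2 m, (n <= m)%N & a m < b m.
  apply: contrapT => /forall2NP nodrop.
  have step j : a (n + j)%N = a n - b n *+ j /\ b (n + j)%N = b n.
    elim: j => [|j [IHa IHb]]; first by rewrite addn0 subr0.
    have [|H] := descent_step D (n + j).
      by move/absorbs_lt; case: (nodrop (n + j)%N) => // /negP; rewrite leq_addr.
    rewrite addnS (absorbs_b H) (absorbs_a H) IHa IHb; split=> //.
    by rewrite mulrS; ring.
  have [j hj] : exists j, a n < b n *+ j.
    exists (Num.bound (a n / b n)); rewrite -mulr_natl -ltr_pdivrMr//.
    by rewrite archi_boundP// ltW// divr_gt0.
  by have := a_gt0 (n + j); rewrite (step j).1 subr_gt0 ltNge (ltW hj).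
have bmono n m : (n <= m)%N -> b m <= b n.
  move=> /subnK <-; elim: (m - n)%N => // j IH; apply: le_trans IH; rewrite addSn.
  case: (descent_step D (j + n)) => H; last by rewrite (absorbs_a H).
  by rewrite (absorbs_b H) lerBlDr lerDl ltW.
have descend j : exists n, b n <= beta - e *+ j.
  elim: j => [|j [n hn]]; first by exists 0%N; rewrite (descent_b0 D) subr0.
  have [m nm abm] := drop n; exists m.+1.
  case: (descent_step D m) => H; last by have := absorbs_lt H; lra.
  have := bmono _ _ nm; have := ae m; rewrite (absorbs_b H) mulrS; lra.
have [j hj] : exists j, beta < e *+ j.
  exists (Num.bound (beta / e)); rewrite -mulr_natl -ltr_pdivrMr//.
  rewrite archi_boundP// divr_ge0 ?ltW//.
  by rewrite -(descent_b0 D).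
by have [n hn] := descend j; have := b_gt0 n; lra.
Qed.

End descent.

(** The earlier step saturates all its endpoints on one of the two sides, while the edges of a later
    step end at vertices that are still unsaturated on that side. *)
Lemma descent_disjoint (R : realType) (alpha beta : R) (p0 q0 : R[i])
    (a : nat -> R) (p : nat -> R[i]) (b : nat -> R) (q : nat -> R[i])
    (s l : nat -> R) (v : nat -> R[i]) :
  descent alpha beta p0 q0 a p b q s l v ->
  forall i j x, x \in `[s i, s i + l i[ -> x \in `[s j, s j + l j[ -> i = j.
Proof.
move=> D i j x; wlog ij : i j / (i < j)%N => [th xi xj|xi xj].
  by case: (ltngtP i j) => // h; [exact: th|apply/esym/th].
have [H|H] := descent_step D i.
- have := descent_absorbed (descent_sym D) H xi; case.
  apply: meets_le (descent_meets (descent_sym D) xj).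
  exact: descent_le (descent_sym D) _ _ ij.
- have := descent_absorbed D H xi; case.
  apply: meets_le (descent_meets D xj).
  exact: descent_le D _ _ ij.
Qed.

(** * Existence of the descent by the Euclidean algorithm *)

(* The lengths [a], [b] carry their integer coordinates in the basis
   [(alpha, beta)]; the unimodularity of the coordinate matrix shows that
   [a] and [b] never become equal. *)
Record euclid_state (R : realType) := EuclidState {
  eu_a1 : int; eu_a2 : int; eu_b1 : int; eu_b2 : int;
  eu_p : R[i]; eu_q : R[i] }.

Section euclid.
Context (R : realType) (alpha beta : R).
Hypotheses (alpha_gt0 : 0 < alpha) (beta_gt0 : 0 < beta).
Hypothesis indep : rationally_independent alpha beta.

Definition eu_a (e : euclid_state R) : R :=
  (eu_a1 e)%:~R * alpha + (eu_a2 e)%:~R * beta.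
Definition eu_b (e : euclid_state R) : R :=
  (eu_b1 e)%:~R * alpha + (eu_b2 e)%:~R * beta.

Definition euclid_step (e : euclid_state R) : euclid_state R :=
  let: EuclidState a1 a2 b1 b2 p q := e in
  if eu_a e < eu_b e then EuclidState a1 a2 (b1 - a1) (b2 - a2) (p - q) q
  else EuclidState (a1 - b1) (a2 - b2) b1 b2 p (q - p).

(** If [eu_a e < eu_b e], this is the [alpha]-component of [eu_b e - eu_a e]: a multiple of [alpha]
    that is congruent to that difference mod [beta]. The other case is symmetric. *)
Definition euclid_shift (e : euclid_state R) : R :=
  if eu_a e < eu_b e then (eu_b1 e - eu_a1 e)%:~R * alpha
  else (eu_a2 e - eu_b2 e)%:~R * beta.

Definition euclid_value (e : euclid_state R) : R[i] :=
  if eu_a e < eu_b e then eu_q e else eu_p e.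

Definition euclid_inv (e : euclid_state R) : Prop :=
  [/\ 0 < eu_a e, 0 < eu_b e & eu_a1 e * eu_b2 e - eu_a2 e * eu_b1 e = 1].

(** By independence, equal lengths would have equal coordinates, making the determinant 0. *)
Lemma euclid_inv_neq (e : euclid_state R) : euclid_inv e -> eu_a e != eu_b e.
Proof.
case: e => a1 a2 b1 b2 p q [_ _ /= det]; apply/eqP; rewrite /eu_a /eu_b /= => ab.
have [|h1 h2] := @indep (a1 - b1) (a2 - b2); first by rewrite !intrB; lra.
by move: det; rewrite (subr0_eq h1) (subr0_eq h2) mulrC subrr.
Qed.

Lemma euclid_step_inv (e : euclid_state R) :
  euclid_inv e -> euclid_inv (euclid_step e).
Proof.
move=> he; have := euclid_inv_neq he; case: he; rewrite /euclid_step /euclid_inv.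
case: (ltgtP (eu_a e) (eu_b e)) => // ab a0 b0 + _; move: ab a0 b0.
all: case: e => a1 a2 b1 b2 p q; rewrite /eu_a /eu_b/= ?intrB => ab a0 b0 det.
all: by split; try lra; rewrite -det; ring.
Qed.

Lemma exists_descent (p q : R[i]) : exists a p' b q' s l v,
  descent alpha beta p q a p' b q' s l v.
Proof.
pose e n := iter n euclid_step (EuclidState 1 0 0 1 p q).
have einv n : euclid_inv (e n).
  elim: n => [|n]; last exact: euclid_step_inv.
  by split; rewrite /eu_a /eu_b /= ?mul0r ?mul1r ?addr0 ?add0r.
exists (eu_a \o e), (@eu_p R \o e), (eu_b \o e), (@eu_q R \o e),
  (euclid_shift \o e), (fun n => Num.min (eu_a (e n)) (eu_b (e n))),
  (euclid_value \o e).
split=> //; rewrite /= ?/eu_a ?/eu_b/= ?mul0r ?mul1r ?addr0 ?add0r//.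
  by move=> n; case: (einv n).
move=> n; have eS : e n.+1 = euclid_step (e n) by [].
have := euclid_inv_neq (einv n).
case: ltgtP => // ab _; [left|right]; split=> //=; rewrite ?eS.
all: rewrite /euclid_step /euclid_shift /euclid_value.
all: try by rewrite (min_idPl (ltW ab)).
all: try by rewrite (min_idPr (ltW ab)).
all: move: ab; case: (e n) => a1 a2 b1 b2 p' q' /= ab.
all: try (rewrite ab; move: ab).
all: try (rewrite ltNge (ltW ab)/=; move: ab).
all: rewrite /eu_a /eu_b/= ?intrB => _; try ring.
- by exists (b1 - a1); rewrite intrB.
- by exists (a2 - b2); rewrite intrB; ring.
- by exists (a2 - b2); rewrite intrB.
- by exists (b1 - a1); rewrite intrB; ring.
Qed.

End euclid.

(** * Functions constant on each of countably many disjoint intervals *)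

Lemma measurable_lebesgueType (R : realType) (A : set R) :
  measurable (A : set (measurableTypeR R)) -> measurable (A : set (lebesgueType R)).
Proof. by move=> mA; exact: sub_caratheodory. Qed.

(** When no interval contains [x], [xget] returns the default index 0, and the factor [x \in I n]
    forces the value 0. *)
Definition piecewise (R : realType) (I : nat -> interval R) (v : nat -> R[i])
    (x : R) : R[i] :=
  let n := xget 0%N [set n | x \in I n] in v n *+ (x \in I n).

Section piecewise.
Context (R : realType) (I : nat -> interval R) (v : nat -> R[i]).
Hypothesis disjI : forall i j x, x \in I i -> x \in I j -> i = j.

Lemma piecewise_in n x : x \in I n -> piecewise I v x = v n.
Proof.
move=> xn; rewrite /piecewise; have -> : xget 0%N [set n | x \in I n] = n.
  by apply: (disjI _ xn); exact: (@xgetI _ 0%N [set n | x \in I n] n).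
by rewrite xn.
Qed.

Lemma piecewise_out x : (forall n, x \notin I n) -> piecewise I v x = 0.
Proof. by move=> xI; rewrite /piecewise (negPf (xI _)). Qed.

Lemma piecewise_partial_sum N x : (forall n, (N <= n)%N -> x \notin I n) ->
  piecewise I v x = \sum_(0 <= i < N) v i *+ (x \in I i).
Proof.
move=> xN; have [[n xn]|/forallNP no] := pselect (exists n, x \in I n).
  have nN : (n < N)%N by rewrite ltnNge; apply: contraL xn; exact: xN.
  rewrite (piecewise_in xn) (bigD1_seq n)/= ?mem_index_iota ?iota_uniq//.
  rewrite xn mulr1n big1 ?addr0// => i ni.
  case: (boolP (x \in I i)) => // xi.
  by rewrite (disjI xi xn) eqxx in ni.
have noI n : x \notin I n by apply/negP; exact: no.
by rewrite (piecewise_out noI) big1// => i _; rewrite (negPf (noI i)).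
Qed.

Lemma piecewise_measurable : lebesgue_measurable_fun (piecewise I v).
Proof.
have mI n : measurable ([set` I n] : set (lebesgueType R)).
  by apply: measurable_lebesgueType; exact: measurable_itv.
move=> _ U _; rewrite setTI.
(* The preimage collects the intervals whose value lies in [U], and the complement of all intervals
   if 0 lies in [U]. *)
have -> : piecewise I v @^-1` U =
    (\bigcup_n (if `[< U (v n) >] then [set` I n] else set0)) `|`
    (if `[< U 0 >] then ~` (\bigcup_n [set` I n]) else set0).
  apply/seteqP; split=> x /=.
    have [[n xn]|/forallNP no] := pselect (exists n, x \in I n).
      by rewrite (piecewise_in xn) => Uv; left; exists n => //; rewrite asboolT.
    rewrite piecewise_out; last by move=> n; apply/negP; exact: no.
    by move=> U0; right; rewrite asboolT// => -[n _]; exact: no.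
  case=> [[n _]|]; case: asboolP => // Uv; first by move=> xn; rewrite (piecewise_in xn).
  by move=> no; rewrite piecewise_out// => n; apply/negP => xn; apply: no; exists n.
apply: measurableU; first by apply: bigcupT_measurable => n; case: ifP.
by case: ifP => // _; apply: measurableC; exact: bigcupT_measurable.
Qed.

End piecewise.

Lemma piecewise_supp (R : realType) (I : nat -> interval R) (v : nat -> R[i]) :
  supp (piecewise I v) `<=` \bigcup_n [set` I n].
Proof.
move=> x; rewrite /supp /piecewise /=.
case: (boolP (x \in I _)) => [xI _|]; last by rewrite mulr0n eqxx.
by exists (xget 0%N [set n | x \in I n]).
Qed.

(** * Measure of the support, and null sets *)

Lemma completed_lebesgue_measure_bigcup (R : realType) (s l : nat -> R) (c : R)
    (A : set R) : (forall n, 0 < l n) ->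
  (forall n, \sum_(0 <= i < n) l i <= c) ->
  A `<=` \bigcup_n [set` `[s n, s n + l n[] ->
  (completed_lebesgue_measure A <= c%:E)%E.
Proof.
move=> l0 lc Asub.
apply: (@le_trans _ _ (\sum_(0 <= n <oo) (l n)%:E)%E); last first.
  apply: lime_le; first by apply: is_cvg_nneseries => n _ _; rewrite lee_fin ltW.
  by apply: nearW => n; rewrite sumEFin lee_fin.
(* The completed measure is given by the outer measure, which is monotone and countably subadditive
   on arbitrary sets. *)
apply: (le_trans (le_outer_measure ((@wlength R idfun)^*)%mu _ _ Asub)).
apply: (le_trans (outer_measure_sigma_subadditive ((@wlength R idfun)^*)%mu
  (fun n => [set` `[s n, s n + l n[]))).
apply: lee_nneseries => // n _.
have := lebesgue_measure_itv `[s n, s n + l n[.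
by rewrite /= lte_fin ltrDl l0 -EFinB [s n + l n]addrC addrK => <-.
Qed.

(** The multiples of [c] form a countable, hence null, set. *)
Lemma ae_off_multiples (R : realType) (c : R) (P : R -> Prop) :
  (forall x, (forall k : int, x != k%:~R * c) -> P x) ->
  {ae completed_lebesgue_measure, forall x : R, P x}.
Proof.
move=> offP; have cA : countable (range (fun k : int => k%:~R * c)).
  exact: sub_countable (card_image_le _ _) (countableP _).
exists (range (fun k : int => k%:~R * c)); split.
- by apply: measurable_lebesgueType; apply: countable_measurable.
- exact: countable_lebesgue_measure0 cA.
- move=> x /= nP; apply: contrapT => xc; apply: nP; apply: offP => k.
  by apply: contra_notN xc => /eqP ->; exists k.
Qed.

(** * Summation over translates and conclusion *)

Lemma descent_sum (R : realType) (alpha beta : R) (p0 q0 : R[i])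
    (a : nat -> R) (p : nat -> R[i]) (b : nat -> R) (q : nat -> R[i])
    (s l : nat -> R) (v : nat -> R[i]) (x : R) :
  descent alpha beta p0 q0 a p b q s l v ->
  (forall k : int, x != k%:~R * alpha) ->
  finitely_sums_to (fun k : int =>
    piecewise (fun n => `[s n, s n + l n[) v (x - k%:~R * alpha)) p0.
Proof.
move=> D xalpha.
have alpha0 : 0 < alpha by rewrite -(descent_a0 D); exact: (descent_gt0 D 0).1.
have [e e0 he] := meets_small alpha0 xalpha.
(* From step [N] on, [x] mod [alpha] is outside [[0, a N[], so nothing is lacking at it. *)
have [N /ltW aN] := descent_small D e0.
have := descent_partial_sum D N x; rewrite asboolF ?subr0; last exact: he.
congr finitely_sums_to; apply/funext => k; apply/esym.
(* Later edges end in [[0, a N[] mod [alpha], so none is a translate of [x], and the first [N]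
   intervals determine the function on all these translates. *)
apply: (piecewise_partial_sum _ (descent_disjoint D)) => n Nn.
apply/negP => /(descent_meets D) /meets_translate.
by apply: he; apply: le_trans aN; exact: descent_le D _ _ Nn.
Qed.

Theorem theorem2p1 (R : realType) (alpha beta : R)
  (alpha_gt0 : 0 < alpha) (beta_gt0 : 0 < beta)
  (indep : rationally_independent alpha beta) (p q : R[i]) :
  exists f : R -> R[i],
    [/\ lebesgue_measurable_fun f,
        (completed_lebesgue_measure (supp f) <= (alpha + beta)%:E)%E,
        {ae completed_lebesgue_measure, forall x : R,
          absolutely_convergent (fun k : int => f (x - k%:~R * alpha)) /\
          sums_to (fun k : int => f (x - k%:~R * alpha)) p}
      & {ae completed_lebesgue_measure, forall x : R,
          absolutely_convergent (fun k : int => f (x - k%:~R * beta)) /\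
          sums_to (fun k : int => f (x - k%:~R * beta)) q}].
Proof.
have [a [p' [b [q' [s [l [v D]]]]]]] := exists_descent alpha_gt0 beta_gt0 indep p q.
exists (piecewise (fun n => `[s n, s n + l n[) v); split.
- exact: piecewise_measurable (descent_disjoint D).
- apply: completed_lebesgue_measure_bigcup (@piecewise_supp _ _ _) => n.
    by case/andP: (descent_length D n).
  have [an bn] := descent_gt0 D n.
  by rewrite (descent_sum_length D); lra.
- apply: (@ae_off_multiples _ alpha) => x xalpha.
  exact/finitely_sums_to_converges/(descent_sum D).
- apply: (@ae_off_multiples _ beta) => x xbeta.
  exact/finitely_sums_to_converges/(descent_sum (descent_sym D)).
Qed.
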